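(* Let $\lambda>0$ and consider the aligned Zipf family with $N=2$: for $s\ge0$, \[ p_1=w_1(s)=\frac{1}{1+2^{-s}},\qquad p_2=w_2(s)=\frac{2^{-s}}{1+2^{-s}}, \] with quorum time $\tau^{(s)}_{2,\theta}$. Fix $\theta\in(1/2,1)$ and set $s_\theta:=\log_2\!\left(\frac{\theta}{1-\theta}\right)$. Then \[ \mathbb{E}[\tau^{(s)}_{2,\theta}]= \begin{cases} \dfrac1\lambda\left(\dfrac1{w_1(s)}+\dfrac1{w_2(s)}-1\right), & 0\le s\le s_\theta,\\[1em] \dfrac{1}{\lambda\,w_1(s)}, & s>s_\theta. \end{cases} \] Moreover, the map $s\mapsto\mathbb{E}[\tau^{(s)}_{2,\theta}]$ is strictly increasing on $[0,s_\theta]$ and strictly decreasing on $(s_\theta,\infty)$. Hence $s\mapsto\mathbb{E}[\tau^{(s)}_{2,\theta}]$ is not monotone on $[0,\infty)$.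
   Context: Let $T_1,T_2$ be independent with $T_i\sim\mathrm{Exp}(\lambda w_i(s))$ (rate $\lambda w_i(s)$). Discovered-mass process: $M^{(s)}_2(t)=w_1(s)\mathbf{1}_{\{T_1\le t\}}+w_2(s)\mathbf{1}_{\{T_2\le t\}}$. Quorum time: $\tau^{(s)}_{2,\theta}=\inf\{t\ge0:M^{(s)}_2(t)>\theta\}$. *)

(* Defs.v *)
From HB Require Import structures.
From mathcomp Require Import all_boot all_order all_algebra.
From mathcomp Require Import all_classical all_reals all_analysis.
Set Implicit Arguments.
Unset Strict Implicit.
Unset Printing Implicit Defensive.
Import Order.TTheory GRing.Theory Num.Theory.
Import numFieldNormedType.Exports.
Local Open Scope classical_set_scope.
Local Open Scope ring_scope.

Definition zipf_w1 (R : realType) (s : R) : R := 1 / (1 + 2 `^ (- s)).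
Definition zipf_w2 (R : realType) (s : R) : R := 2 `^ (- s) / (1 + 2 `^ (- s)).

Definition log2 (R : realType) (x : R) : R := ln x / ln 2.

Definition s_crit (R : realType) (theta : R) : R := log2 (theta / (1 - theta)).

Definition independent_RV (R : realType) (d : measure_display)
    (Omega : measurableType d) (P : probability Omega R)
    (X Y : {RV P >-> R}) : Prop :=
  forall A B : set R, measurable A -> measurable B ->
    P (X @^-1` A `&` Y @^-1` B) = (P (X @^-1` A) * P (Y @^-1` B))%E.

Definition exponentially_distributed (R : realType) (d : measure_display)
    (Omega : measurableType d) (P : probability Omega R)
    (X : {RV P >-> R}) (rate : R) : Prop :=
  forall A : set R, measurable A -> distribution P X A = exponential_prob rate A.

Definition discovered_mass (R : realType) (Omega : Type) (w1 w2 : R)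
    (T1 T2 : Omega -> R) (t : R) (o : Omega) : R :=
  w1 * (T1 o <= t)%R%:R + w2 * (T2 o <= t)%R%:R.

(* The infimum is taken in [\bar R], so that it is +oo if the quorum is never
   reached, whereas [inf set0 = 0] in [R]. *)
Definition quorum_time (R : realType) (Omega : Type) (w1 w2 theta : R)
    (T1 T2 : Omega -> R) (o : Omega) : \bar R :=
  ereal_inf [set t%:E | t in
    [set t : R | 0 <= t /\ discovered_mass w1 w2 T1 T2 t o > theta]].

(* ['E_P[X]] only accepts real-valued [X]; this is its unfolding for an
   extended-real-valued variable. *)
Definition expected_quorum_time (R : realType) (d : measure_display)
    (Omega : measurableType d) (P : probability Omega R) (w1 w2 theta : R)
    (T1 T2 : Omega -> R) : \bar R :=
  (\int[P]_o quorum_time w1 w2 theta T1 T2 o)%E.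

(* Main.v *)
(* For s <= s_crit no single node exceeds theta, so the quorum time is
   max(T1, T2).  With rates a = lambda w1 and b = lambda w2, independence gives
   P(max(T1, T2) > t) = e^(-at) + e^(-bt) - e^(-(a+b)t), where a + b = lambda,
   and integrating this tail gives 1/a + 1/b - 1/lambda.  For s > s_crit the
   first node alone is a quorum and the second alone is not, so the quorum time
   is T1.  The times may be negative on a null set, hence the maxima with 0. *)
Require Import Defs.
From HB Require Import structures.
From mathcomp Require Import all_boot all_order all_algebra.
From mathcomp Require Import all_classical all_reals all_analysis.
From mathcomp Require Import measurable_realfun ring lra.
Set Implicit Arguments.
Unset Strict Implicit.
Unset Printing Implicit Defensive.
Import Order.TTheory GRing.Theory Num.Theory.
Import numFieldNormedType.Exports.
Local Open Scope classical_set_scope.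
Local Open Scope ring_scope.

(** * Exponential integrals on half-lines *)

Lemma measurable_expRM (R : realType) (c : R) (D : set R) :
  measurable_fun D (fun t : R => expR (c * t)).
Proof.
apply: measurable_funTS; apply: continuous_measurable_fun => x.
by apply: continuous_comp; [exact: mulrl_continuous|exact: continuous_expR].
Qed.

(** The antiderivative [- e^(-r x) / r] tends to 0 at infinity because [r > 0], so only its value at
    [a] contributes. *)
Lemma integral_expRNM (R : realType) (r a : R) : 0 < r ->
  (\int[lebesgue_measure]_(x in `[a, +oo[) (expR (- r * x))%:E
     = (expR (- r * a) / r)%:E)%E.
Proof.
move=> r0; have rN0 : r != 0 by rewrite gt_eqF.
have cexp : continuous (fun x : R => expR (- r * x)).
  move=> x; apply: continuous_comp; last exact: continuous_expR.
  exact: mulrl_continuous.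
pose F (x : R) := - r^-1 * expR (- r * x).
have FE : forall x : R, is_derive x 1 F (expR (- r * x)).
  move=> x; rewrite /F; apply: is_derive_eq.
  by rewrite /GRing.scale /=; field.
rewrite (@ge0_continuous_FTC2y _ _ F a 0).
- by rewrite sub0e -EFinN; congr (_%:E); rewrite /F; field.
- by move=> x _; exact: expR_ge0.
- exact: continuous_subspaceT.
- rewrite -(mulr0 (- r^-1)); apply: cvgMl_tmp.
  rewrite (_ : (fun x => expR (- r * x)) =
               (fun z => expR (- z)) \o (fun z => r * z)); last first.
    by apply: eq_fun => x; rewrite mulNr.
  apply: (@cvg_comp _ _ _ _ _ _ (pinfty_nbhs R)); last exact: cvgr_expR.
  exact: gt0_cvgMry.
- by move=> x _; exact: ex_derive.
- by apply/cvg_at_right_filter; apply: cvgMl_tmp; exact: cexp.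
- by move=> x _; rewrite derive1E; exact: derive_val.
Qed.

Lemma exponential_prob_itvoy (R : realType) (r t : R) : 0 < r -> 0 <= t ->
  exponential_prob r `]t, +oo[ = (expR (- r * t))%:E.
Proof.
(* Adding the null endpoint [t] matches the closed half-line of [integral_expRNM]; since [t >= 0],
   the density there is [r e^(-r x)] throughout. *)
move=> r0 t0; rewrite /exponential_prob integral_itv_obnd_cbnd; last first.
  by apply/measurable_EFinP/measurable_funTS; exact: measurable_exponential_pdf.
transitivity (\int[lebesgue_measure]_(x in `[t, +oo[)
    (r%:E * (expR (- r * x))%:E))%E.
  apply: eq_integral => x; rewrite inE/= in_itv/= andbT => tx.
  by rewrite exponential_pdfE// (le_trans t0).
rewrite ge0_integralZl//=; last 2 first.
- by apply/measurable_EFinP; exact: measurable_expRM.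
- by rewrite lee_fin ltW.
by rewrite integral_expRNM// -EFinM; congr (_%:E); rewrite mulrCA mulfV ?mulr1 ?gt_eqF.
Qed.

(** * Expectations from tail probabilities *)

Lemma ge0_integral_tail (R : realType) (d : measure_display)
    (T : measurableType d) (P : probability T R) (f : T -> R) :
  measurable_fun [set: T] f -> (forall x, 0 <= f x) ->
  (\int[P]_x (f x)%:E =
   \int[lebesgue_measure]_(r in `[0%R, +oo[) P [set x | (r < f x)%R])%E.
Proof.
(* Bundling [f] as a random variable turns its integral into an expectation, to which the tail
   formula applies. *)
move=> mf f0; pose X : {RV P >-> R} := mfun_Sub (mem_set mf).
have XE : X = f :> (T -> R) by rewrite /X mfun_valP.
rewrite -XE -expectation_def ge0_expectation_ccdf; last by rewrite XE.
apply: eq_integral => r _; congr (P _); rewrite XE.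
by apply/seteqP; split => x /=; rewrite in_itv/= andbT.
Qed.

Lemma exponential_tail (R : realType) (d : measure_display)
    (T : measurableType d) (P : probability T R) (X : {RV P >-> R}) (a t : R) :
  0 < a -> exponentially_distributed X a -> 0 <= t ->
  P (X @^-1` `]t, +oo[) = (expR (- a * t))%:E.
Proof. by move=> a0 Xexp t0; rewrite -(exponential_prob_itvoy a0 t0) -Xexp. Qed.

Lemma expectation_exponential (R : realType) (d : measure_display)
    (T : measurableType d) (P : probability T R) (X : {RV P >-> R}) (a : R) :
  0 < a -> exponentially_distributed X a ->
  (\int[P]_x (Num.max (X x) 0)%:E = a^-1%:E)%E.
Proof.
move=> a0 Xexp; rewrite ge0_integral_tail; last 2 first.
- exact: measurable_maxr.
- by move=> x; rewrite le_max lexx orbT.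
(* Writing [1/a] as the integral of [e^(-a t)] reduces the claim to equality of integrands; for
   [t >= 0] the truncation at 0 does not affect the event. *)
have := integral_expRNM 0 a0; rewrite mulr0 expR0 mul1r => <-.
apply: eq_integral => t; rewrite inE/= in_itv/= andbT => t0.
rewrite -(exponential_tail a0 Xexp)//; congr (P _).
by apply/seteqP; split => x /=; rewrite in_itv/= andbT lt_max (ltNge t 0) t0 orbF.
Qed.

Lemma expectation_max_exponential (R : realType) (d : measure_display)
    (T : measurableType d) (P : probability T R) (X Y : {RV P >-> R})
    (a b : R) :
  0 < a -> 0 < b -> exponentially_distributed X a ->
  exponentially_distributed Y b -> independent_RV X Y ->
  (\int[P]_x (Num.max (Num.max (X x) (Y x)) 0)%:E
     = (a^-1 + b^-1 - (a + b)^-1)%:E)%E.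
Proof.
move=> a0 b0 Xexp Yexp XY; have ab0 : 0 < a + b by rewrite addr_gt0.
have iexp (c : R) : 0 < c -> (\int[lebesgue_measure]_(x in `[0%R, +oo[)
    (expR (- c * x))%:E = c^-1%:E)%E.
  by move=> c0; rewrite integral_expRNM// mulr0 expR0 mul1r.
have tail (t : R) : 0 <= t ->
    P [set x | t < Num.max (Num.max (X x) (Y x)) 0] =
    (expR (- a * t) + expR (- b * t) - expR (- (a + b) * t))%:E.
  move=> t0; pose A := X @^-1` `]t, +oo[; pose B := Y @^-1` `]t, +oo[.
  have AE : P A = (expR (- a * t))%:E.
    exact: exponential_tail.
  have BE : P B = (expR (- b * t))%:E.
    exact: exponential_tail.
  rewrite (_ : [set _ | _] = A `|` B); last first.
    apply/seteqP; split => x; rewrite /A /B /= !in_itv/= !andbT;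
      rewrite !lt_max (ltNge t 0) t0 orbF; first by move/orP.
    by move=> /orP.
  (* Inclusion-exclusion; the subtraction is legitimate because [P A] is finite. *)
  have -> : (P (A `|` B) = P A + P B - P (A `&` B))%E.
    apply: measureUfinl; [exact: measurable_funPTI|exact: measurable_funPTI|].
    by rewrite (_ : _ A = (expR (- a * t))%:E) ?ltry.
  have -> : P (A `&` B) = (P A * P B)%E by exact: XY.
  rewrite AE BE -!EFinM -EFinD.
  by rewrite -expRD opprD mulrDl.
rewrite ge0_integral_tail; last 2 first.
- by apply: measurable_maxr => //; exact: measurable_maxr.
- by move=> x; rewrite le_max lexx orbT.
set I := (X in X = _).
(* The negative term of the tail is moved to the left, so that additivity is used for nonnegative
   integrands only; the finite constant is subtracted at the end. *)
have : (I + (a + b)^-1%:E = a^-1%:E + b^-1%:E)%E.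
  rewrite -!iexp// -!ge0_integralD//.
  - apply: eq_integral => t; rewrite inE/= in_itv/= andbT => t0.
    by rewrite tail// -!EFinD subrK.
  - by apply/measurable_EFinP; exact: measurable_expRM.
  - by apply/measurable_EFinP; exact: measurable_expRM.
  - apply: (eq_measurable_fun (fun t : R =>
      (expR (- a * t) + expR (- b * t) - expR (- (a + b) * t))%:E)).
      by move=> t; rewrite inE/= in_itv/= andbT => t0; rewrite tail.
    apply/measurable_EFinP.
    by apply: measurable_funB; [apply: measurable_funD|]; exact: measurable_expRM.
  - by apply/measurable_EFinP; exact: measurable_expRM.
move=> /(congr1 (fun z => z - (a + b)^-1%:E)%E).
by rewrite addeK// -EFinD -EFinB.
Qed.

(** * Closed forms of the quorum time *)

(** In both regimes the quorum condition reduces to [c <= t] for a suitable [c], and the infimum is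
    then attained. *)
Lemma ereal_inf_ge0_ge (R : realType) (c : R) :
  ereal_inf [set t%:E | t in [set t : R | 0 <= t /\ c <= t]]
  = (Num.max c 0)%:E.
Proof.
apply/eqP; rewrite eq_le; apply/andP; split.
  apply: ereal_inf_lbound; exists (Num.max c 0) => //=.
  by rewrite !le_max !lexx orbT.
apply: le_ereal_inf_tmp => _ [t [t0 ct] <-].
by rewrite lee_fin ge_max ct.
Qed.

(** Of the four possible masses [0], [w1], [w2], [w1 + w2], only the last exceeds [theta]. *)
Lemma quorum_time_both (R : realType) (Omega : Type) (w1 w2 theta : R)
    (T1 T2 : Omega -> R) (o : Omega) :
  0 <= theta -> w1 <= theta -> w2 <= theta -> theta < w1 + w2 ->
  quorum_time w1 w2 theta T1 T2 o = (Num.max (Num.max (T1 o) (T2 o)) 0)%:E.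
Proof.
move=> th0 w1th w2th thw; rewrite -ereal_inf_ge0_ge /quorum_time.
congr (ereal_inf (image _ _)); apply/seteqP.
split => t /= [t0]; rewrite /discovered_mass ge_max => H; split => //.
  move: H; case: (T1 o <= t); case: (T2 o <= t) => //=;
    by rewrite ?mulr1 ?mulr0 ?addr0 ?add0r ltNge ?w1th ?w2th ?th0.
by case/andP: H => -> ->; rewrite !mulr1.
Qed.

(** The masses exceeding [theta] are exactly those containing [w1], whatever the state of the second
    node. *)
Lemma quorum_time_first (R : realType) (Omega : Type) (w1 w2 theta : R)
    (T1 T2 : Omega -> R) (o : Omega) :
  0 <= w2 -> w2 <= theta -> theta < w1 ->
  quorum_time w1 w2 theta T1 T2 o = (Num.max (T1 o) 0)%:E.
Proof.
move=> w20 w2th thw1; rewrite -ereal_inf_ge0_ge /quorum_time.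
congr (ereal_inf (image _ _)); apply/seteqP.
split => t /= [t0]; rewrite /discovered_mass => H; split => //.
  move: H; case: (T1 o <= t) => //; rewrite mulr0 add0r ltNge.
  by case: (T2 o <= t) => /=; rewrite ?mulr1 ?mulr0 ?w2th ?(le_trans w20).
by rewrite H mulr1 (lt_le_trans thw1)// lerDl mulr_ge0.
Qed.

(** * Thresholds and monotonicity of the Zipf weights *)

Section zipf.
Context (R : realType).
Implicit Types s theta : R.

Lemma powR2N_gt0 s : 0 < 2 `^ (- s) :> R.
Proof. exact: powR_gt0. Qed.

Lemma ltr_powR2N s s' : s < s' -> 2 `^ (- s') < 2 `^ (- s) :> R.
Proof.
move=> ss'; rewrite -ltr_ln ?posrE ?powR2N_gt0// !ln_powR.
by rewrite ltr_pM2r ?ltrN2// ln_gt0// ltr1n.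
Qed.

Lemma powR2N_le1 s : 0 <= s -> 2 `^ (- s) <= 1 :> R.
Proof.
rewrite le_eqVlt => /predU1P[<-|/ltr_powR2N/ltW]; first by rewrite oppr0 powRr0.
by rewrite oppr0 powRr0.
Qed.

(** With [v = 2^s], both inequalities amount to [v (1 - theta) <= theta]. *)
Lemma zipf_w1_le theta s : 0 < theta -> theta < 1 ->
  (zipf_w1 s <= theta) = (s <= s_crit theta).
Proof.
move=> th0 th1; have q0 : 0 < theta / (1 - theta) by rewrite divr_gt0 ?subr_gt0.
rewrite /s_crit /log2 ler_pdivlMr ?ln_gt0 ?ltr1n// -ln_powR.
rewrite ler_ln ?posrE ?powR_gt0// /zipf_w1 powRN.
have := powR_gt0 s (ltr0n R 2); move: (2 `^ s) => v v0.
rewrite ler_pdivlMr ?subr_gt0// ler_pdivrMr ?addr_gt0 ?invr_gt0//.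
rewrite -(ler_pM2r v0) mul1r -mulrA mulrDl mulVf ?gt_eqF// mul1r.
by apply/idP/idP => h; lra.
Qed.

Lemma s_crit_gt0 theta : 1 / 2 < theta -> theta < 1 -> 0 < s_crit theta.
Proof.
move=> th0 th1; rewrite divr_gt0 ?ln_gt0 ?ltr1n//.
by rewrite ltr_pdivlMr ?subr_gt0//; lra.
Qed.

Lemma zipf_w1_gt0 s : 0 < zipf_w1 s.
Proof. by rewrite divr_gt0 ?addr_gt0 ?powR2N_gt0. Qed.

Lemma zipf_w2_gt0 s : 0 < zipf_w2 s.
Proof. by rewrite divr_gt0 ?addr_gt0 ?powR2N_gt0. Qed.

Lemma zipf_sum1 s : zipf_w1 s + zipf_w2 s = 1.
Proof.
rewrite /zipf_w1 /zipf_w2; have := powR2N_gt0 s; move: (2 `^ _) => u u0.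
by field; rewrite gt_eqF ?addr_gt0.
Qed.

(** As [theta > 1/2], this bound shows that the second node alone is never a quorum. *)
Lemma zipf_w2_le_half s : 0 <= s -> zipf_w2 s <= 1 / 2.
Proof.
move=> /powR2N_le1; rewrite /zipf_w2.
have := powR2N_gt0 s; move: (2 `^ _) => u u0 u1.
by rewrite ler_pdivrMr ?addr_gt0//; lra.
Qed.

Lemma inv_zipf_w1 s : 1 / zipf_w1 s = 1 + 2 `^ (- s).
Proof. by rewrite /zipf_w1 !div1r invrK. Qed.

Lemma inv_zipf_w2 s : 1 / zipf_w2 s = 1 + (2 `^ (- s))^-1.
Proof.
rewrite /zipf_w2; have := powR2N_gt0 s; move: (2 `^ _) => u u0.
by field; rewrite !gt_eqF ?addr_gt0.
Qed.

Lemma inv_zipf_w1_decr s s' : s < s' -> 1 / zipf_w1 s' < 1 / zipf_w1 s.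
Proof. by move=> ss'; rewrite !inv_zipf_w1 ltrD2l ltr_powR2N. Qed.

(* With u = 2^-s the sum is 2 + u + 1/u, and u + 1/u decreases on (0, 1]. *)
Lemma inv_zipf_sum_incr s s' : 0 <= s -> s < s' ->
  1 / zipf_w1 s + 1 / zipf_w2 s < 1 / zipf_w1 s' + 1 / zipf_w2 s'.
Proof.
move=> /powR2N_le1 u1 /ltr_powR2N; rewrite !inv_zipf_w1 !inv_zipf_w2.
have := powR2N_gt0 s'; move: (2 `^ (- s')) (2 `^ (- s)) u1 => v u u1 v0 vu.
have u0 : 0 < u := lt_trans v0 vu.
rewrite -subr_gt0.
(* Every factor is positive, since [0 < v < u <= 1] gives [u v < 1]. *)
have -> : 1 + v + (1 + v^-1) - (1 + u + (1 + u^-1))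
    = (u - v) * (1 - u * v) / (u * v).
  by field; rewrite !gt_eqF.
rewrite divr_gt0 ?mulr_gt0 ?subr_gt0//.
by rewrite (lt_le_trans _ u1)// -{2}[u]mulr1 ltr_pM2l// (lt_le_trans vu).
Qed.

End zipf.

Theorem theorem8p1 (R : realType) (lambda theta : R)
    (d : R -> measure_display) (Omega : forall s : R, measurableType (d s))
    (P : forall s : R, probability (Omega s) R)
    (T1 T2 : forall s : R, {RV (P s) >-> R})
    (lambda_gt0 : 0 < lambda)
    (theta_gt : 1 / 2 < theta) (theta_lt1 : theta < 1)
    (T1_exp : forall s : R, 0 <= s ->
       exponentially_distributed (T1 s) (lambda * zipf_w1 s))
    (T2_exp : forall s : R, 0 <= s ->
       exponentially_distributed (T2 s) (lambda * zipf_w2 s))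
    (T_indep : forall s : R, 0 <= s -> independent_RV (T1 s) (T2 s)) :
  let Etau (s : R) : \bar R :=
    expected_quorum_time (P s) (zipf_w1 s) (zipf_w2 s) theta (T1 s) (T2 s) in
  [/\ forall s : R, 0 <= s ->
        Etau s = (if s <= s_crit theta
                  then 1 / lambda * (1 / zipf_w1 s + 1 / zipf_w2 s - 1)
                  else 1 / (lambda * zipf_w1 s))%:E,
      forall s s' : R, 0 <= s -> s < s' -> s' <= s_crit theta ->
        (Etau s < Etau s')%E,
      forall s s' : R, s_crit theta < s -> s < s' ->
        (Etau s' < Etau s)%E
    & ~ ((forall s s' : R, 0 <= s -> s <= s' -> (Etau s <= Etau s')%E) \/
         (forall s s' : R, 0 <= s -> s <= s' -> (Etau s' <= Etau s)%E))].
Proof.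
move=> Etau.
have th0 : 0 < theta by lra.
have w1rate s : 0 < lambda * zipf_w1 s by rewrite mulr_gt0 ?zipf_w1_gt0.
have w2rate s : 0 < lambda * zipf_w2 s by rewrite mulr_gt0 ?zipf_w2_gt0.
have sc0 := s_crit_gt0 theta_gt theta_lt1.
have w2le s : 0 <= s -> zipf_w2 s <= theta.
  by move=> /zipf_w2_le_half h; rewrite (le_trans h)// ltW.
have EtauE (s : R) : 0 <= s ->
    Etau s = (if s <= s_crit theta
              then 1 / lambda * (1 / zipf_w1 s + 1 / zipf_w2 s - 1)
              else 1 / (lambda * zipf_w1 s))%:E.
  (* The case split on [s] becomes one on [w1 <= theta], the form in which the quorum time is
     known. *)
  move=> s0; rewrite /Etau /expected_quorum_time -zipf_w1_le//.
  case: leP => hw1.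
    under eq_integral => o _.
      rewrite quorum_time_both ?(ltW th0) ?w2le ?zipf_sum1//; over.
    rewrite (expectation_max_exponential (w1rate s) (w2rate s))//; last 3 first.
    - exact: T1_exp.
    - exact: T2_exp.
    - exact: T_indep.
    congr (_%:E); rewrite -mulrDr zipf_sum1.
    by field; rewrite !gt_eqF ?zipf_w1_gt0 ?zipf_w2_gt0.
  under eq_integral => o _.
    rewrite quorum_time_first ?(ltW (zipf_w2_gt0 s)) ?w2le//; over.
  by rewrite (expectation_exponential (w1rate s)) ?div1r//; exact: T1_exp.
have incr (s s' : R) : 0 <= s -> s < s' -> s' <= s_crit theta ->
    (Etau s < Etau s')%E.
  move=> s0 ss' s'c; rewrite !EtauE//; last exact: le_trans (ltW ss').
  rewrite s'c (le_trans (ltW ss') s'c) lte_fin ltr_pM2l ?divr_gt0//.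
  by rewrite ltrD2r inv_zipf_sum_incr.
have decr (s s' : R) : s_crit theta < s -> s < s' -> (Etau s' < Etau s)%E.
  move=> sc ss'; have sc' := lt_trans sc ss'.
  rewrite !EtauE ?(ltW (lt_trans sc0 _))// !leNgt sc sc' /= lte_fin.
  have E r : 1 / (lambda * zipf_w1 r) = lambda^-1 * (1 / zipf_w1 r).
    by field; rewrite !gt_eqF ?zipf_w1_gt0.
  by rewrite !E ltr_pM2l ?invr_gt0 ?inv_zipf_w1_decr.
(* A nondecreasing map is refuted at [s_crit + 1] and [s_crit + 2], both strictly beyond the
   threshold; a nonincreasing one at [0 < s_crit]. *)
split => // -[mono|mono].
- have c1 : s_crit theta < s_crit theta + 1 by rewrite ltrDl.
  have c2 : s_crit theta + 1 < s_crit theta + 1 + 1 by rewrite ltrDl.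
  have := mono _ _ (ltW (lt_trans sc0 c1)) (ltW c2).
  by rewrite leNgt decr.
- by have := mono _ _ (lexx 0) (ltW sc0); rewrite leNgt incr.
Qed.
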